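(* Let $p=(3+\sqrt3)/6$ and consider the following single-solve explicit algorithm with implicit treatment of velocity (Algorithm 2) for $M\ddot u=f(\dot u,u,t)$ with time step $\Delta t$. First $\ddot u_{n+p}$ is determined from $$M\ddot u_{n+p}=f(\dot u_{n+p},u_{n+p},t_n+p\Delta t),$$ $$\dot u_{n+p}=\dot u_n+\Delta t\Big(\tfrac{12p^2-6p+1}{12p}\ddot u_n+\tfrac{6p-1}{12p}\ddot u_{n+p}\Big),\qquad u_{n+p}=u_n+p\Delta t\,\dot u_n+\tfrac{p^2}{2}\Delta t^2\,\ddot u_n,$$ and then $$u_{n+1}=u_n+\Delta t\,\dot u_n+\Delta t^2\Big(\tfrac{6p^2-1}{12p}\ddot u_n+\tfrac{-6p^2+6p+1}{12p}\ddot u_{n+p}\Big),$$ $$\dot u_{n+1}=\dot u_n+\Delta t\Big(\tfrac{2p-1}{2p}\ddot u_n+\tfrac1{2p}\ddot u_{n+p}\Big),\qquad \ddot u_{n+1}=\tfrac{p-1}{p}\ddot u_n+\tfrac1p\ddot u_{n+p}.$$ Applied to the test equation $\ddot u+2\xi\omega\dot u+\omega^2u=f(t)$ with any $\xi\in[0,1)$, $\omega\in(0,\infty)$ and $f\in C^\infty(\mathbb R)$, this algorithm is third-order accurate in displacement and in velocity and second-order accurate in acceleration, that is, $\tau_u=\mathcal O(\Delta t^3)$, $\tau_{\dot u}=\mathcal O(\Delta t^3)$, $\tau_{\ddot u}=\mathcal O(\Delta t^2)$.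
   Context: **One-step form.** For the scalar test equation $\ddot u(t)+2\xi\omega\dot u(t)+\omega^2u(t)=f(t)$, $\xi\in[0,1)$, $\omega\in(0,\infty)$, $f\in C^\infty(\mathbb R)$ (so $M=1$ and the force is $f(t)-2\xi\omega\dot u-\omega^2u$), the algorithm maps $X_n=(u_n,\dot u_n,\ddot u_n)^{\mathsf T}$ at $t_n$ to $X_{n+1}$ at $t_n+\Delta t$ in the form $$X_{n+1}=D_{\rm num}X_n+L_{\rm num}(t_n).$$ Here $D_{\rm num}$ is the $3\times3$ matrix collecting the dependence on $X_n$, and $L_{\rm num}(t_n)$ is the vector collecting the terms containing $f(t_n+p\Delta t)$, obtained by solving the (scalar linear) relation for $\ddot u_{n+p}$ and eliminating it; the relation is uniquely solvable since $1+2\xi\omega\Delta t\,\frac{6p-1}{12p}>0$. **Order of accuracy.** Let $\det(\lambda I_3-D_{\rm num})=\sum_{j=0}^3A_j\lambda^j$ (so $A_3=1$; the $A_j$ depend on $\Delta t$). For an exact solution $u$ of the test equation put $X(t)=(u(t),\dot u(t),\ddot u(t))^{\mathsf T}$ and $t_{n+i}=t_n+i\Delta t$. The local truncation error vector is $$\tau=(\tau_u,\tau_{\dot u},\tau_{\ddot u})^{\mathsf T}=\frac1{\Delta t^2}\Big(\sum_{i=0}^3A_iX(t_{n+i})-\sum_{i=0}^3A_i\sum_{j=0}^{i-1}D_{\rm num}^{\,j}L_{\rm num}(t_{n-j+i-1})\Big).$$ The algorithm is $r$-th-order accurate in displacement (resp. velocity, acceleration) if $\tau_u=\mathcal O(\Delta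 t^r)$ (resp. $\tau_{\dot u}$, $\tau_{\ddot u}$) as $\Delta t\to0$, for every $f\in C^\infty(\mathbb R)$, every exact solution $u$ and every $t_n$, with $\omega,\xi$ fixed. *)

(* Defs.v *)
From HB Require Import structures.
From mathcomp Require Import all_boot all_order all_algebra.
From mathcomp Require Import all_classical all_reals all_analysis.

Set Implicit Arguments.
Unset Strict Implicit.
Unset Printing Implicit Defensive.

Import Order.TTheory GRing.Theory Num.Theory.
Import numFieldNormedType.Exports.

Local Open Scope classical_set_scope.
Local Open Scope ring_scope.

Section Defs.
Context {R : realType}.

Definition smooth (f : R -> R) : Prop :=
  forall (n : nat) (t : R), derivable f^`(n)%classic t 1.

Definition state (u v a : R) : 'cV[R]_3 := \col_i [:: u; v; a]`_i.

Definition displacement : 'I_3 := @Ordinal 3 0 isT.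
Definition velocity : 'I_3 := @Ordinal 3 1 isT.
Definition acceleration : 'I_3 := @Ordinal 3 2 isT.

(* A method for M u'' = F(u', u, t): the relation
     method M F dt t u v a u1 v1 a1
   says that (u1, v1, a1) is an admissible value at t + dt
   starting from (u, v, a) at t. *)
Definition method : Type :=
  R -> (R -> R -> R -> R) -> R -> R -> R -> R -> R -> R -> R -> R -> Prop.

(* ap, vp, up stand for the acceleration, velocity and displacement at
   t + p dt; the equation for ap is implicit, since F may depend on vp. *)
Definition single_solve (p : R) : method :=
  fun M F dt t u v a u1 v1 a1 =>
  exists ap vp up : R,
    [/\ M * ap = F vp up (t + p * dt),
        vp = v + dt * ((12 * p ^+ 2 - 6 * p + 1) / (12 * p) * a
                       + (6 * p - 1) / (12 * p) * ap)
      & up = u + p * dt * v + p ^+ 2 / 2 * dt ^+ 2 * a] /\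
    [/\ u1 = u + dt * v
             + dt ^+ 2 * ((6 * p ^+ 2 - 1) / (12 * p) * a
                          + (- 6 * p ^+ 2 + 6 * p + 1) / (12 * p) * ap),
        v1 = v + dt * ((2 * p - 1) / (2 * p) * a + 1 / (2 * p) * ap)
      & a1 = (p - 1) / p * a + 1 / p * ap].

(* the test equation u'' + 2 xi omega u' + omega^2 u = f, as M u'' = F(u', u, t)
   with M = 1 *)
Definition test_force (xi omega : R) (f : R -> R) (v u t : R) : R :=
  f t - 2 * xi * omega * v - omega ^+ 2 * u.

Definition test_solution (xi omega : R) (f u : R -> R) : Prop :=
  forall t : R,
    [/\ derivable u t 1, derivable u^`()%classic t 1
      & u^`(2)%classic t + 2 * xi * omega * u^`()%classic t
        + omega ^+ 2 * u t = f t].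

Definition exact_state (u : R -> R) (t : R) : 'cV[R]_3 :=
  state (u t) (u^`()%classic t) (u^`(2)%classic t).

(* D dt is the amplification matrix and L f dt t the load vector. The
   equivalence includes the unique solvability of the step, and determines
   D dt and L f dt t: see one_step_form_unique. *)
Definition one_step_form (alg : method) (xi omega : R) (D : R -> 'M[R]_3)
    (L : (R -> R) -> R -> R -> 'cV[R]_3) : Prop :=
  forall (f : R -> R) (dt : R), smooth f -> 0 < dt ->
  forall t u v a u1 v1 a1 : R,
    alg 1 (test_force xi omega f) dt t u v a u1 v1 a1 <->
    state u1 v1 a1 = D dt *m state u v a + L f dt t.

(* [char_poly D] is \det (X I - D), so its coefficients are the A_i; the load
   L is evaluated at t_(n - j + i - 1) = t + (i - j - 1) dt. *)
Definition truncation_error (D : 'M[R]_3) (L : R -> 'cV[R]_3) (u : R -> R)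
    (t dt : R) : 'cV[R]_3 :=
  (dt ^+ 2)^-1 *:
  (\sum_(i < 4) (char_poly D)`_i *: exact_state u (t + i%:R * dt)
   - \sum_(i < 4) (char_poly D)`_i *:
       \sum_(j < i) (D ^+ j *m L (t + (i%:R - j%:R - 1) * dt))).

Definition order_accurate (alg : method) (xi omega : R) (c : 'I_3) (r : nat)
    : Prop :=
  exists (D : R -> 'M[R]_3) (L : (R -> R) -> R -> R -> 'cV[R]_3),
    one_step_form alg xi omega D L /\
    forall f u : R -> R, smooth f -> test_solution xi omega f u ->
    forall t : R,
      (fun dt : R => truncation_error (D dt) (L f dt) u t dt c 0)
        =O_ (0^'+) (fun dt : R => dt ^+ r).

Lemma stateE (X : 'cV[R]_3) :
  X = state (X displacement 0) (X velocity 0) (X acceleration 0).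
Proof.
apply/matrixP => i j; rewrite !mxE (ord1 j).
by case: i => [[|[|[|//]]] Hi] /=; congr (X _ _); apply: val_inj.
Qed.

Lemma one_step_form_unique (alg : method) (xi omega : R) D L D' L' :
  one_step_form alg xi omega D L -> one_step_form alg xi omega D' L' ->
  forall (f : R -> R) (dt t : R), smooth f -> 0 < dt ->
    D dt = D' dt /\ L f dt t = L' f dt t.
Proof.
move=> H H' f dt t sf dt0.
have E X : D dt *m X + L f dt t = D' dt *m X + L' f dt t.
  rewrite (stateE X); set Y := LHS; rewrite (stateE Y).
  by apply/(H' f dt sf dt0)/(H f dt sf dt0); rewrite -stateE.
have EL : L f dt t = L' f dt t by have := E 0; rewrite !mulmx0 !add0r.
split=> //; have := E; rewrite EL => {}E.
have {}E (X : 'cV_3) : D dt *m X = D' dt *m X by have /addIr := E X.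
apply/matrixP => i j.
by have /matrixP/(_ i 0) := E (delta_mx j 0); rewrite -!colE !mxE.
Qed.

End Defs.

(* Main.v *)
(* If e(t) denotes the error of one step started from exact data, unrolling
   the recursion and the Cayley-Hamilton theorem give
     dt^2 tau = sum_i A_i sum_(j < i) D^j e(t_(n+i-j-1)).
   The one-step errors are only O(dt^4), O(dt^3) and O(dt^2) in displacement,
   velocity and acceleration; the missing orders come from the expansion
     sum_i A_i sum_(j < i) D^j e_(i-j-1)
       = adj(I - D) e_0 + (e_2 - e_0) + (D - tr D) (e_1 - e_0)
   because I - D is nearly singular, and because the leading velocity and
   acceleration errors, which feed into the displacement and velocity rows
   with weights 1/p and (2p-1)/(2p), cancel exactly when
   6 p^2 - 6 p + 1 = 0. *)

Require Import Defs.
From mathcomp Require Import all_boot all_order all_algebra.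
From mathcomp Require Import all_classical all_reals all_analysis.
From mathcomp Require Import ring lra.
Import Order.TTheory GRing.Theory Num.Theory.
Import numFieldNormedType.Exports.
Local Open Scope ring_scope.

(** * One-sided order bounds as [h] tends to 0 from the right *)

Section Asymptotics.
Local Open Scope classical_set_scope.
Local Open Scope ring_scope.
Context {R : realType}.
Implicit Types (f g : R -> R) (m n : nat).

(** Landau bounds with an explicit constant; [0 <= C] lets them be multiplied and compared.
    [bigO_powP] returns to the library notation at the end. *)
Definition bigO_pow n g : Prop :=
  exists2 C : R, 0 <= C & \forall h \near (0 : R)^'+, `|g h| <= C * h ^+ n.

Lemma near0 : \forall h \near (0 : R)^'+, 0 < h < 1.
Proof.
near=> h; apply/andP; split; near: h; [exact: nbhs_right_gt|].
exact: nbhs_right_lt.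
Unshelve. all: by end_near. Qed.

(** Identities involving the inverse [stage_scale] are established for positive [h], so equality is
    asked only near 0 on the right. *)
Lemma bigO_pow_near n f g :
  (\forall h \near (0 : R)^'+, f h = g h) -> bigO_pow n g -> bigO_pow n f.
Proof.
move=> fg [C C0 Cg]; exists C => //; near=> h.
by rewrite (near fg h) //; near: h.
Unshelve. all: by end_near. Qed.

Lemma bigO_pow_eq n f g : f =1 g -> bigO_pow n g -> bigO_pow n f.
Proof. by move=> fg; apply: bigO_pow_near; near=> h.
Unshelve. all: by end_near. Qed.

Lemma bigO_powD n f g :
  bigO_pow n f -> bigO_pow n g -> bigO_pow n (fun h => f h + g h).
Proof.
move=> [C C0 Cf] [D D0 Dg]; exists (C + D); first exact: addr_ge0.
near=> h; rewrite mulrDl (le_trans (ler_normD _ _))// lerD//; near: h => //.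
Unshelve. all: by end_near. Qed.

Lemma bigO_powN n f : bigO_pow n f -> bigO_pow n (fun h => - f h).
Proof.
by move=> [C C0 Cf]; exists C => //; near=> h; rewrite normrN; near: h.
Unshelve. all: by end_near. Qed.

Lemma bigO_powB n f g :
  bigO_pow n f -> bigO_pow n g -> bigO_pow n (fun h => f h - g h).
Proof. by move=> Of Og; apply: bigO_powD => //; exact: bigO_powN. Qed.

Lemma bigO_powM m n f g :
  bigO_pow m f -> bigO_pow n g -> bigO_pow (m + n) (fun h => f h * g h).
Proof.
move=> [C C0 Cf] [D D0 Dg]; exists (C * D); first exact: mulr_ge0.
near=> h; rewrite normrM exprD mulrACA ler_pM//; near: h => //.
Unshelve. all: by end_near. Qed.

Lemma bigO_pow_le m n f : (m <= n)%N -> bigO_pow n f -> bigO_pow m f.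
Proof.
move=> mn [C C0 Cf]; exists C => //; near=> h.
have /andP[h0 h1] : 0 < h < 1 by near: h; exact: near0.
apply: le_trans (_ : C * h ^+ n <= _); first by near: h.
by rewrite ler_wpM2l// ler_wiXn2l// ltW.
Unshelve. all: by end_near. Qed.

Lemma bigO_powX n : bigO_pow n (fun h => h ^+ n).
Proof.
exists 1 => //; near=> h; have h0 : 0 < h by near: h; exact: nbhs_right_gt.
by rewrite mul1r ger0_norm// exprn_ge0// ltW.
Unshelve. all: by end_near. Qed.

Lemma bigO_powc (c : R) : bigO_pow 0 (fun=> c).
Proof. by exists `|c| => //; near=> h; rewrite expr0 mulr1.
Unshelve. all: by end_near. Qed.

Lemma bigO_powZ n (c : R) g : bigO_pow n g -> bigO_pow n (fun h => c * g h).
Proof. exact: (bigO_powM _ _ _ _ (bigO_powc c)). Qed.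

Lemma bigO_pow_cX n (c : R) : bigO_pow n (fun h => c * h ^+ n).
Proof. exact/bigO_powZ/bigO_powX. Qed.

Lemma bigO_powP n g :
  bigO_pow n g -> g =O_ (0^'+) (fun h : R => h ^+ n).
Proof.
move=> [C C0 Cg]; apply/eqO_exP; exists (C + 1); first by rewrite ltr_wpDl.
near=> h; have h0 : 0 < h by near: h; exact: nbhs_right_gt.
rewrite /= [X in _ <= _ * X]gtr0_norm ?exprn_gt0//.
apply: le_trans (_ : C * h ^+ n <= _); first by near: h.
by rewrite ler_pM2r ?exprn_gt0// lerDl.
Unshelve. all: by end_near. Qed.

Lemma bigO_pow_divX m n g :
  bigO_pow (m + n) g -> bigO_pow n (fun h => (h ^+ m)^-1 * g h).
Proof.
move=> [C C0 Cg]; exists C => //; near=> h.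
have h0 : 0 < h by near: h; exact: nbhs_right_gt.
rewrite normrM normfV (gtr0_norm (exprn_gt0 m h0)) mulrC.
rewrite ler_pdivrMr ?exprn_gt0// -mulrA -exprD addnC.
by near: h.
Unshelve. all: by end_near. Qed.

Lemma bigO_pow_continuous g : {for 0, continuous g} -> bigO_pow 0 g.
Proof.
move=> /cvgr_norm_le /(_ (`|g 0| + 1)) Cg; exists (`|g 0| + 1).
  by rewrite addr_ge0.
near=> h; rewrite expr0 mulr1; near: h.
by apply: cvg_within; apply: Cg; rewrite ltrDl.
Unshelve. all: by end_near. Qed.

(** By the mean value theorem [g h = dg c * h] with [0 < c < h], and [c ^+ n <= h ^+ n]. This is the
    induction step of Taylor's formula. *)
Lemma bigO_pow_integral n g dg :
  (forall x : R, is_derive x 1 g (dg x)) -> g 0 = 0 ->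
  bigO_pow n dg -> bigO_pow n.+1 g.
Proof.
move=> g_dg g0 [C C0 Cdg]; exists C => //.
(* The bound is needed at the intermediate point [c], not at [h], so the radius of its neighbourhood
   is made explicit. *)
have [e /= e0 He] := Cdg.
near=> h; have h0 : 0 < h by near: h; exact: nbhs_right_gt.
have [c cI] : exists2 c, c \in `]0, h[ & g h - g 0 = dg c * (h - 0).
  apply: MVT => //.
  apply: derivable_within_continuous => x _; exact: ex_derive.
rewrite g0 !subr0 => ->; rewrite normrM (gtr0_norm h0) exprSr mulrA.
move: cI; rewrite in_itv /= => /andP[c0 ch].
rewrite (ler_wpM2r (ltW h0))//; apply: le_trans (_ : C * c ^+ n <= _).
  apply: He => //=; rewrite sub0r normrN gtr0_norm//.
  by apply: lt_trans ch _; near: h; exact: nbhs_right_lt.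
by rewrite ler_wpM2l// lerXn2r// ?nnegrE ltW// (lt_trans c0).
Unshelve. all: by end_near. Qed.

End Asymptotics.

(** * Taylor's formula with an order bound on the remainder *)

Section Taylor.
Local Open Scope classical_set_scope.
Local Open Scope ring_scope.
Context {R : realType}.

(** The indeterminate is the increment from [t]; with [n] terms the degree is below [n] and the
    remainder has order [n]. *)
Definition taylor_poly (g : R -> R) (t : R) (n : nat) : {poly R} :=
  \poly_(j < n) (g^`(j)%classic t / j`!%:R).

Lemma smooth_derive (g : R -> R) : smooth g -> smooth g^`()%classic.
Proof. by move=> sg n t; rewrite -derive1Sn. Qed.

Lemma smooth_is_derive (g : R -> R) (x : R) :
  smooth g -> is_derive x 1 g (g^`()%classic x).
Proof. by move=> /(_ 0%N x) dg; rewrite derive1E; exact/derivableP. Qed.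

Lemma deriv_taylor_poly (g : R -> R) (t : R) (n : nat) :
  ((taylor_poly g t n.+1)^`())%R = taylor_poly g^`()%classic t n.
Proof.
apply/polyP => j; rewrite coef_deriv !coef_poly ltnS derive1Sn.
case: ifP => // _; last by rewrite mul0rn.
rewrite factS natrM -mulr_natr.
by field; rewrite nat1r !pnatr_eq0 -!lt0n fact_gt0.
Qed.

(** Induction on [n]: the derivative in [h] of the remainder is [th] times the remainder of the
    derivative of [g] with one term fewer, and the remainder vanishes at [h = 0]. The base case is
    continuity. *)
Lemma taylor_bigO (g : R -> R) (t th : R) (n : nat) : smooth g ->
  bigO_pow n (fun h => g (t + th * h) - (taylor_poly g t n).[th * h]).
Proof.
elim: n g => [|n IHn] g sg.
  apply: bigO_pow_eq (_ : bigO_pow 0 (g \o (fun h => t + th * h))).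
    by move=> h /=; rewrite horner_poly big_ord0 subr0.
  apply: bigO_pow_continuous; apply: continuous_comp.
    by apply: cvgD; [exact: cvg_cst|apply: cvgM; [exact: cvg_cst|exact: cvg_id]].
  apply: differentiable_continuous; apply/derivable1_diffP; exact: (sg 0%N).
have affine (s x : R) : is_derive x 1 (fun h : R => s + th * h) th.
  have := is_deriveD (is_derive_cst s x 1) (is_deriveZ th (is_derive_id x 1)).
  by move/is_derive_eq; apply; rewrite add0r /GRing.scale /= mulr1.
apply: (@bigO_pow_integral _ _ _ (fun h =>
    th * (g^`()%classic (t + th * h) - (taylor_poly g^`()%classic t n).[th * h]))).
- move=> x.
  have dg := @is_derive1_comp _ _ (fun h => t + th * h) x _ _
    (smooth_is_derive g (t + th * x) sg) (affine t x).
  have dp := @is_derive1_comp _ _ (fun h => 0 + th * h) x _ _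
    (is_derive_poly (taylor_poly g t n.+1) (0 + th * x)) (affine 0 x).
  have := is_deriveB dg dp; rewrite deriv_taylor_poly add0r -mulrBl mulrC.
  congr is_derive; apply/funext => h.
  by rewrite !fctE /= add0r.
- by rewrite mulr0 addr0 horner_coef0 coef_poly /= divr1 subrr.
- exact/bigO_powZ/IHn/smooth_derive.
Qed.

End Taylor.

(** * Three-by-three determinants and characteristic polynomials *)

Lemma big_ord3 (V : nmodType) (F : 'I_3 -> V) :
  \sum_i F i = F displacement + F velocity + F acceleration.
Proof.
rewrite !big_ord_recl big_ord0 addr0 addrA.
by congr (F _ + F _ + F _); apply: val_inj.
Qed.

Lemma det_mx33 (R : comNzRingType) (A : 'M[R]_3)
    (i := displacement) (j := velocity) (k := acceleration) :
  \det A = A i i * (A j j * A k k - A j k * A k j)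
         - A i j * (A j i * A k k - A j k * A k i)
         + A i k * (A j i * A k j - A j j * A k i).
Proof.
have det2 (B : 'M[R]_2) : \det B = B 0 0 * B 1 1 - B 0 1 * B 1 0.
  rewrite (expand_det_row _ 0) !big_ord_recl big_ord0 /cofactor !det_mx11 !mxE.
  rewrite /= !(expr0, expr1) addr0 mul1r mulN1r mulrN.
  by congr (_ * B _ _ - B _ _ * B _ _); apply: val_inj.
rewrite (expand_det_row _ i) big_ord3 /cofactor !det2 !mxE /=.
have -> : lift i (0 : 'I_2) = j by apply: val_inj.
have -> : lift i (1 : 'I_2) = k by apply: val_inj.
have -> : lift velocity (0 : 'I_2) = i by apply: val_inj.
have -> : lift velocity (1 : 'I_2) = k by apply: val_inj.
have -> : lift acceleration (0 : 'I_2) = i by apply: val_inj.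
have -> : lift acceleration (1 : 'I_2) = j by apply: val_inj.
by rewrite !(expr0, expr1, expr2); ring.
Qed.

Lemma char_poly_mx33 (R : comNzRingType) (A : 'M[R]_3)
    (i := displacement) (j := velocity) (k := acceleration) :
  char_poly A = 'X^3 - (\tr A)%:P * 'X^2
    + (A i i * A j j - A i j * A j i + (A i i * A k k - A i k * A k i)
       + (A j j * A k k - A j k * A k j))%:P * 'X
    - (\det A)%:P.
Proof.
rewrite /char_poly /char_poly_mx !det_mx33 /mxtrace big_ord3 !mxE /=.
rewrite !(mulr1n, mulr0n, sub0r) -/i -/j -/k.
ring.
Qed.

Lemma coef_char_poly3 (R : comNzRingType) (A : 'M[R]_3)
    (i := displacement) (j := velocity) (k := acceleration) :
  [/\ (char_poly A)`_3 = 1, (char_poly A)`_2 = - \tr A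
    & (char_poly A)`_1 =
      A i i * A j j - A i j * A j i + (A i i * A k k - A i k * A k i)
      + (A j j * A k k - A j k * A k j)].
Proof.
split; last 2 first.
- exact: char_poly_trace.
- rewrite char_poly_mx33 !(coefD, coefN, coefXn, coefCM, coefX, coefC) /=.
  by rewrite -/i -/j -/k; ring.
have := char_poly_monic A; rewrite monicE /lead_coef size_char_poly.
by move/eqP.
Qed.

(** Cayley-Hamilton written with the coefficients [A_i], the form in which the exact states enter
    the truncation error. *)
Lemma Cayley_Hamilton_sum (R : comNzRingType) n (A : 'M[R]_n.+1) :
  \sum_(i < n.+2) (char_poly A)`_i *: A ^+ i = 0.
Proof.
rewrite -[RHS](Cayley_Hamilton A) -[in RHS](coefK (char_poly A)) size_char_poly.
rewrite poly_def raddf_sum; apply: eq_bigr => i _.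
by rewrite /= horner_mxZ rmorphXn /= horner_mx_X.
Qed.

(** * Truncation error in terms of one-step errors *)

Section TruncationError.
Context {R : realType}.

Definition local_error (D : 'M[R]_3) (L : R -> 'cV[R]_3) (u : R -> R)
    (dt t : R) : 'cV[R]_3 :=
  exact_state u (t + dt) - D *m exact_state u t - L t.

(** Iterates [X(t + dt) = D X(t) + L(t) + e(t)]; the input of step [n - j - 1] is afterwards
    multiplied by [D] exactly [j] times. *)
Lemma exact_stateD (D : 'M[R]_3) L u dt t (n : nat) :
  exact_state u (t + n%:R * dt) = D ^+ n *m exact_state u t
    + \sum_(j < n) D ^+ j *m (L (t + (n%:R - j%:R - 1) * dt)
                              + local_error D L u dt (t + (n%:R - j%:R - 1) * dt)).
Proof.
have DX m : D *m D ^+ m = D ^+ m.+1 by rewrite exprS.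
elim: n => [|n IHn]; first by rewrite mul0r addr0 big_ord0 addr0 expr0 mul1mx.
have -> : exact_state u (t + n.+1%:R * dt) = D *m exact_state u (t + n%:R * dt)
    + (L (t + n%:R * dt) + local_error D L u dt (t + n%:R * dt)).
  rewrite /local_error [RHS]addrC [L _ + _]addrC !subrK.
  by congr (exact_state u _); ring.
rewrite IHn mulmxDr mulmxA DX -addrA; congr (_ + _).
rewrite big_ord_recl subr0 expr0 mul1mx mulrSr addrK addrC; congr (_ + _).
rewrite mulmx_sumr; apply: eq_bigr => j _.
rewrite mulmxA DX lift0.
by have -> : n%:R + 1 - j.+1%:R - 1 = n%:R - j%:R - 1 :> R by rewrite mulrSr; ring.
Qed.

Lemma truncation_error_local (D : 'M[R]_3) L u t dt :
  truncation_error D L u t dt = (dt ^+ 2)^-1 *: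
    \sum_(i < 4) (char_poly D)`_i *: \sum_(j < i) D ^+ j *m
      local_error D L u dt (t + (i%:R - j%:R - 1) * dt).
Proof.
congr (_ *: _); rewrite -sumrB.
transitivity (\sum_(i < 4) (((char_poly D)`_i *: D ^+ i) *m exact_state u t +
    (char_poly D)`_i *: \sum_(j < i) D ^+ j *m
      local_error D L u dt (t + (i%:R - j%:R - 1) * dt))).
  apply: eq_bigr => i _; rewrite (exact_stateD D L) -scalemxAl -scalerBr -scalerDr.
  congr (_ *: _); rewrite -addrA; congr (_ + _); rewrite -sumrB.
  by apply: eq_bigr => j _; rewrite mulmxDr addrC addKr.
by rewrite big_split /= -mulmx_suml Cayley_Hamilton_sum mul0mx add0r.
Qed.

(* [N = I - D]; the coefficients of the [e 0] are the entries of [\adj N]. *)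
Lemma truncation_error_components (D : 'M[R]_3) L u t dt
    (e := fun k : nat => local_error D L u dt (t + k%:R * dt))
    (N := 1%:M - D)
    (i := displacement) (j := velocity) (k := acceleration) :
  [/\ truncation_error D L u t dt i 0 = (dt ^+ 2)^-1 *
        ((N j j * N k k - N j k * N k j) * e 0 i 0
         - (N i j * N k k - N i k * N k j) * e 0 j 0
         + (N i j * N j k - N i k * N j j) * e 0 k 0
         + ((e 2 i 0 - e 0 i 0) + (N j j + N k k - 2) * (e 1 i 0 - e 0 i 0)
            - N i j * (e 1 j 0 - e 0 j 0) - N i k * (e 1 k 0 - e 0 k 0))),
      truncation_error D L u t dt j 0 = (dt ^+ 2)^-1 *
        (- (N j i * N k k - N j k * N k i) * e 0 i 0
         + (N i i * N k k - N i k * N k i) * e 0 j 0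
         - (N i i * N j k - N i k * N j i) * e 0 k 0
         + ((e 2 j 0 - e 0 j 0) + (N i i + N k k - 2) * (e 1 j 0 - e 0 j 0)
            - N j i * (e 1 i 0 - e 0 i 0) - N j k * (e 1 k 0 - e 0 k 0)))
    & truncation_error D L u t dt k 0 = (dt ^+ 2)^-1 *
        ((N j i * N k j - N j j * N k i) * e 0 i 0
         - (N i i * N k j - N i j * N k i) * e 0 j 0
         + (N i i * N j j - N i j * N j i) * e 0 k 0
         + ((e 2 k 0 - e 0 k 0) + (N i i + N j j - 2) * (e 1 k 0 - e 0 k 0)
            - N k i * (e 1 i 0 - e 0 i 0) - N k j * (e 1 j 0 - e 0 j 0)))].
Proof.
(* Only [A_3 = 1], [A_2 = - \tr D] and [A_1] appear, because the inner sum for [i = 0] is empty. *)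
have -> : truncation_error D L u t dt = (dt ^+ 2)^-1 *:
    (e 2 + (D *m e 1 + D *m (D *m e 0))
     - \tr D *: (e 1 + D *m e 0) + (char_poly D)`_1 *: e 0).
  have [A3 A2 _] := @coef_char_poly3 R D.
  rewrite truncation_error_local; congr (_ *: _).
  rewrite !big_ord_recl !big_ord0 /= /bump /= !add1n A3 A2.
  have E (a b : R) (m : nat) : a - b - 1 = m%:R ->
    local_error D L u dt (t + (a - b - 1) * dt) = e m by move=> ->.
  rewrite (E _ _ 0); last by ring.
  rewrite (E _ _ 1); last by ring.
  rewrite (E _ _ 0); last by ring.
  rewrite (E _ _ 2); last by ring.
  rewrite (E _ _ 1); last by ring.
  rewrite (E _ _ 0); last by ring.
  rewrite !addr0 expr0 !mul1mx expr1 expr2 -mulmxE -mulmxA scaler0 add0r scale1r.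
  by rewrite scaleNr [LHS]addrC [- _ + _]addrC.
have [_ _ ->] := @coef_char_poly3 R D.
have NE x y : N x y = (x == y)%:R - D x y by rewrite !mxE.
rewrite !NE /mxtrace big_ord3 -/i -/j -/k /=; clear N NE.
move: (e 0) (e 1) (e 2) => e0 e1 e2; clear e.
have mulE (v : 'cV[R]_3) x : (D *m v) x 0 = D x i * v i 0 + D x j * v j 0 + D x k * v k 0.
  by rewrite mxE big_ord3.
have addE (v w : 'cV[R]_3) x : (v + w) x 0 = v x 0 + w x 0 by rewrite mxE.
have oppE (v : 'cV[R]_3) x : (- v) x 0 = - v x 0 by rewrite mxE.
have scaleE c (v : 'cV[R]_3) x : (c *: v) x 0 = c * v x 0 by rewrite mxE.
rewrite !(mulE, addE, oppE, scaleE).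
split; ring.
Qed.

End TruncationError.

(** * Regularity of exact solutions *)

Section TestSolution.
Context {R : realType}.
Local Open Scope classical_set_scope.
Local Open Scope ring_scope.

Lemma derive1nD (g : R -> R) (i j : nat) : (g^`(i))^`(j)%classic = g^`(i + j)%classic.
Proof. by rewrite /derive1n addnC iterD. Qed.

Lemma smooth_deriven (g : R -> R) (i : nat) : smooth g -> smooth g^`(i)%classic.
Proof. by move=> sg n t; rewrite derive1nD. Qed.

Lemma taylor_deriven_bigO (g : R -> R) (t th : R) (i n : nat) : smooth g ->
  bigO_pow n (fun h => g^`(i)%classic (t + th * h) -
    \sum_(j < n) g^`(i + j)%classic t / j`!%:R * (th * h) ^+ j).
Proof.
move=> sg; apply: bigO_pow_eq (taylor_bigO _ t th n (smooth_deriven _ i sg)).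
move=> h; rewrite horner_poly; congr (_ - _).
by apply: eq_bigr => j _; rewrite derive1nD.
Qed.

Lemma test_solution_derive2 (xi omega : R) (f u : R -> R) :
  test_solution xi omega f u -> u^`(2)%classic =
  fun t => f t - 2 * xi * omega * u^`()%classic t - omega ^+ 2 * u t.
Proof. by move=> su; apply/funext => t; have [_ _ <-] := su t; ring. Qed.

(** Bootstrapping: the [n] times differentiated equation expresses [u^(n+2)] by [f^(n)], [u^(n+1)]
    and [u^(n)], so differentiability climbs one order at a time. *)
Lemma test_solution_smooth (xi omega : R) (f u : R -> R) :
  smooth f -> test_solution xi omega f u -> smooth u.
Proof.
move=> sf su.
have step (g0 g1 g2 : R -> R) (x : R) :
    derivable g0 x 1 -> derivable g1 x 1 -> derivable g2 x 1 ->
    is_derive x 1 (fun t => g0 t - 2 * xi * omega * g1 t - omega ^+ 2 * g2 t)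
      (g0^`()%classic x - 2 * xi * omega * g1^`()%classic x
         - omega ^+ 2 * g2^`()%classic x).
  move=> /derivableP d0 /derivableP d1 /derivableP d2; rewrite !derive1E.
  exact: is_deriveB (is_deriveB d0 (is_deriveZ _ d1)) (is_deriveZ _ d2).
have main n : [/\ forall t, derivable u^`(n)%classic t 1,
    forall t, derivable u^`(n.+1)%classic t 1 &
    u^`(n.+2)%classic = fun t => f^`(n)%classic t
      - 2 * xi * omega * u^`(n.+1)%classic t - omega ^+ 2 * u^`(n)%classic t].
  elim: n => [|n [dn dn1 eqn]].
    split; [by move=> t; have [? _ _] := su t|by move=> t; have [_ ? _] := su t|].
    exact: test_solution_derive2.
  have d x := step _ _ _ x (sf n x) (dn1 x) (dn x).
  split; [exact: dn1|by move=> t; rewrite eqn; have [] := d t|].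
  rewrite (derive1nS u n.+2) [in LHS]eqn; apply/funext => x; rewrite derive1E.
  by have [_ ->] := d x; rewrite -!derive1nS.
by move=> n t; have [] := main n.
Qed.

End TestSolution.

(** * Order conditions for the three components *)

Ltac bigO_auto :=
  match goal with |- bigO_pow ?n ?g => change (bigO_pow n (fun h => g h)) end;
  cbv beta;
  match goal with
  | H : bigO_pow _ ?g |- bigO_pow _ ?g => solve [apply: bigO_pow_le H; done]
  | H : bigO_pow _ ?g |- bigO_pow _ (fun h => ?g h) => solve [apply: bigO_pow_le H; done]
  | |- bigO_pow _ (fun h => _ + - _) => apply: bigO_powB; bigO_auto
  | |- bigO_pow _ (fun h => _ + _) => apply: bigO_powD; bigO_auto
  | |- bigO_pow _ (fun h => - _) => apply: bigO_powN; bigO_auto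
  | _ => exact: bigO_powc
  | |- bigO_pow ?n (fun h => ?c * _) => solve [apply: bigO_powZ; bigO_auto]
  | |- bigO_pow _ (fun h => ?c * h ^+ _) =>
      solve [apply: bigO_pow_le (bigO_pow_cX _ c); done]
  | |- bigO_pow ?n (fun h => _ * _) => bigO_split n 0%N
  end
(* For a product, the ways of sharing the required order between the two factors are tried in turn,
   starting with all of it on the left factor. *)
with bigO_split m n :=
  first [ solve [apply: (bigO_powM m n); bigO_auto]
        | match m with S ?m' => bigO_split m' (S n) end ].

(* [n11], ..., [n33] are the entries of [I - D], and [eu k], [ev k], [ea k] the
   components of the one-step error at [t + k h], as functions of [h]. *)
Section OrderConditions.
Context {R : realType}.
(** In the application [q = 1/p] and [y = (2p-1)/(2p)]; [b] and [a] are the leading coefficients of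
    the velocity and acceleration errors, and [b'] and [a'] their time derivatives, which measure
    the drift from step to step. *)
Variables (q y a a' b b' : R).
Variables n11 n12 n13 n21 n22 n23 n31 n32 n33 : R -> R.
Variables eu ev ea : nat -> R -> R.
Hypothesis ab : q * b + y * a = 0.
Hypothesis ab' : q * b' + y * a' = 0.
Hypothesis N11 : bigO_pow 2 n11.
Hypothesis N12 : bigO_pow 2 (fun h => n12 h + h).
Hypothesis N13 : bigO_pow 2 n13.
Hypothesis N21 : bigO_pow 1 n21.
Hypothesis N22 : bigO_pow 1 n22.
Hypothesis N23 : bigO_pow 2 (fun h => n23 h + y * h).
Hypothesis N31 : bigO_pow 0 n31.
Hypothesis N32 : bigO_pow 0 n32.
Hypothesis N33 : bigO_pow 1 (fun h => n33 h - q).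
Hypothesis Eu0 : bigO_pow 4 (eu 0).
Hypothesis Eu : forall k, bigO_pow 5 (fun h => eu k h - eu 0 h).
Hypothesis Ev0 : bigO_pow 4 (fun h => ev 0 h - b * h ^+ 3).
Hypothesis Ev : forall k, bigO_pow 5 (fun h => ev k h - ev 0 h - k%:R * b' * h ^+ 4).
Hypothesis Ea0 : bigO_pow 3 (fun h => ea 0 h - a * h ^+ 2).
Hypothesis Ea : forall k, bigO_pow 4 (fun h => ea k h - ea 0 h - k%:R * a' * h ^+ 3).

Let id1 : bigO_pow 1 (fun h : R => h).
Proof. exact: bigO_powX 1. Qed.

Let N12' : bigO_pow 1 n12.
Proof.
by apply: bigO_pow_eq (_ : bigO_pow 1 (fun h => (n12 h + h) - h));
  [move=> h; ring|bigO_auto].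
Qed.

Let N23' : bigO_pow 1 n23.
Proof.
by apply: bigO_pow_eq (_ : bigO_pow 1 (fun h => (n23 h + y * h) - y * h));
  [move=> h; ring|bigO_auto].
Qed.

Let N33' : bigO_pow 0 n33.
Proof.
by apply: bigO_pow_eq (_ : bigO_pow 0 (fun h => (n33 h - q) + q));
  [move=> h; ring|bigO_auto].
Qed.

Let Ev0' : bigO_pow 3 (ev 0).
Proof.
by apply: bigO_pow_eq (_ : bigO_pow 3 (fun h => (ev 0 h - b * h ^+ 3) + b * h ^+ 3));
  [move=> h; ring|bigO_auto].
Qed.

Let Ea0' : bigO_pow 2 (ea 0).
Proof.
by apply: bigO_pow_eq (_ : bigO_pow 2 (fun h => (ea 0 h - a * h ^+ 2) + a * h ^+ 2));
  [move=> h; ring|bigO_auto].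
Qed.

Let Ev' k : bigO_pow 4 (fun h => ev k h - ev 0 h).
Proof.
apply: bigO_pow_eq (_ : bigO_pow 4 (fun h =>
  (ev k h - ev 0 h - k%:R * b' * h ^+ 4) + k%:R * b' * h ^+ 4)).
  by move=> h; ring.
have := Ev k; move=> ?; bigO_auto.
Qed.

Let Ea' k : bigO_pow 3 (fun h => ea k h - ea 0 h).
Proof.
apply: bigO_pow_eq (_ : bigO_pow 3 (fun h =>
  (ea k h - ea 0 h - k%:R * a' * h ^+ 3) + k%:R * a' * h ^+ 3)).
  by move=> h; ring.
have := Ea k; move=> ?; bigO_auto.
Qed.

(** The products [- n12 * n33 * ev 0] and [n12 * n23 * ea 0] contribute [q b h^4] and [y a h^4],
    which cancel by [ab]; all other terms have order 5 by counting powers. *)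
Lemma order_displacement : bigO_pow 5 (fun h =>
  (n22 h * n33 h - n23 h * n32 h) * eu 0 h
  - (n12 h * n33 h - n13 h * n32 h) * ev 0 h
  + (n12 h * n23 h - n13 h * n22 h) * ea 0 h
  + ((eu 2 h - eu 0 h) + (n22 h + n33 h - 2) * (eu 1 h - eu 0 h)
     - n12 h * (ev 1 h - ev 0 h) - n13 h * (ea 1 h - ea 0 h))).
Proof.
have Eu1 := Eu 1; have Eu2 := Eu 2; have Ev1 := Ev' 1; have Ea1 := Ea' 1.
apply: bigO_powD; last by bigO_auto.
apply: bigO_pow_eq (_ : bigO_pow 5 (fun h =>
  (n22 h * n33 h - n23 h * n32 h) * eu 0 h
  + n13 h * n32 h * ev 0 h - n13 h * n22 h * ea 0 h
  - (n12 h + h) * n33 h * ev 0 h + h * (n33 h - q) * ev 0 h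
  + h * (q * (ev 0 h - b * h ^+ 3))
  + (n12 h + h) * n23 h * ea 0 h - h * (n23 h + y * h) * ea 0 h
  + h * (h * (y * (ea 0 h - a * h ^+ 2))))).
  move=> h; apply/eqP; rewrite -subr_eq0; apply/eqP.
  (* Subtracting the leading terms changes the sum by exactly this multiple of [h ^+ 4], which is
     zero. *)
  by transitivity ((q * b + y * a) * h ^+ 4); [ring|rewrite ab; ring].
bigO_auto.
Qed.

(** Here the cancellation occurs between steps: the differences contribute
    [2 b' + (q - 2) b' + y a'] at [h^4], which is zero by [ab']. *)
Lemma order_velocity : bigO_pow 5 (fun h =>
  - (n21 h * n33 h - n23 h * n31 h) * eu 0 h
  + (n11 h * n33 h - n13 h * n31 h) * ev 0 h
  - (n11 h * n23 h - n13 h * n21 h) * ea 0 h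
  + ((ev 2 h - ev 0 h) + (n11 h + n33 h - 2) * (ev 1 h - ev 0 h)
     - n21 h * (eu 1 h - eu 0 h) - n23 h * (ea 1 h - ea 0 h))).
Proof.
have Eu1 := Eu 1; have Ev1 := Ev 1; have Ev2 := Ev 2; have Ea1 := Ea 1.
have Ev1' := Ev' 1; have Ea1' := Ea' 1.
apply: bigO_powD; first by bigO_auto.
apply: bigO_pow_eq (_ : bigO_pow 5 (fun h =>
  (ev 2 h - ev 0 h - 2%:R * b' * h ^+ 4)
  + n11 h * (ev 1 h - ev 0 h)
  + (n33 h - q) * (ev 1 h - ev 0 h)
  + (q - 2) * (ev 1 h - ev 0 h - 1%:R * b' * h ^+ 4)
  - n21 h * (eu 1 h - eu 0 h)
  - (n23 h + y * h) * (ea 1 h - ea 0 h)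
  + h * (y * (ea 1 h - ea 0 h - 1%:R * a' * h ^+ 3)))).
  move=> h; apply/eqP; rewrite -subr_eq0; apply/eqP.
  by transitivity ((q * b' + y * a') * h ^+ 4); [ring|rewrite ab'; ring].
bigO_auto.
Qed.

(** The drift of the acceleration error cancels in the second difference [ea 2 - 2 ea 1 + ea 0],
    leaving order 4. *)
Lemma order_acceleration : bigO_pow 4 (fun h =>
  (n21 h * n32 h - n22 h * n31 h) * eu 0 h
  - (n11 h * n32 h - n12 h * n31 h) * ev 0 h
  + (n11 h * n22 h - n12 h * n21 h) * ea 0 h
  + ((ea 2 h - ea 0 h) + (n11 h + n22 h - 2) * (ea 1 h - ea 0 h)
     - n31 h * (eu 1 h - eu 0 h) - n32 h * (ev 1 h - ev 0 h))).
Proof.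
have Eu1 := Eu 1; have Ev1 := Ev' 1; have Ea1 := Ea 1; have Ea2 := Ea 2.
have Ea1' := Ea' 1.
apply: bigO_powD; first by bigO_auto.
apply: bigO_pow_eq (_ : bigO_pow 4 (fun h =>
  (ea 2 h - ea 0 h - 2%:R * a' * h ^+ 3)
  - 2 * (ea 1 h - ea 0 h - 1%:R * a' * h ^+ 3)
  + (n11 h + n22 h) * (ea 1 h - ea 0 h)
  - n31 h * (eu 1 h - eu 0 h) - n32 h * (ev 1 h - ev 0 h))).
  by move=> h; ring.
bigO_auto.
Qed.

End OrderConditions.

(** * Expansions of stage defects and one-step errors *)

Section TaylorExpansions.
Context {R : realType}.
Local Open Scope classical_set_scope.
Local Open Scope ring_scope.
Variables (du : nat -> R -> R) (t : R).
Hypothesis du_taylor : forall th i n, bigO_pow n (fun h => du i (t + th * h) -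
  \sum_(j < n) du (i + j)%N t / j`!%:R * (th * h) ^+ j).

Lemma taylor3 th i : bigO_pow 3 (fun h => du i (t + th * h)
  - (du i t + du i.+1 t * (th * h) + du i.+2 t / 2 * (th * h) ^+ 2)).
Proof.
apply: bigO_pow_eq (du_taylor th i 3) => h.
rewrite !big_ord_recl big_ord0 /= /bump /= !add1n !(addnS, addn0).
rewrite (_ : 0`! = 1)%N // (_ : 1`! = 1)%N // (_ : 2`! = 2)%N //; by field.
Qed.

Lemma taylor4 th i : bigO_pow 4 (fun h => du i (t + th * h)
  - (du i t + du i.+1 t * (th * h) + du i.+2 t / 2 * (th * h) ^+ 2
     + du i.+3 t / 6 * (th * h) ^+ 3)).
Proof.
apply: bigO_pow_eq (du_taylor th i 4) => h.
rewrite !big_ord_recl big_ord0 /= /bump /= !add1n !(addnS, addn0).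
rewrite (_ : 0`! = 1)%N // (_ : 1`! = 1)%N // (_ : 2`! = 2)%N //.
rewrite (_ : 3`! = 6)%N //; by field.
Qed.

Lemma taylor5 th i : bigO_pow 5 (fun h => du i (t + th * h)
  - (du i t + du i.+1 t * (th * h) + du i.+2 t / 2 * (th * h) ^+ 2
     + du i.+3 t / 6 * (th * h) ^+ 3 + du i.+4 t / 24 * (th * h) ^+ 4)).
Proof.
apply: bigO_pow_eq (du_taylor th i 5) => h.
rewrite !big_ord_recl big_ord0 /= /bump /= !add1n !(addnS, addn0).
rewrite (_ : 0`! = 1)%N // (_ : 1`! = 1)%N // (_ : 2`! = 2)%N //.
rewrite (_ : 3`! = 6)%N // (_ : 4`! = 24)%N //; by field.
Qed.

Variables (p : R).
Hypothesis p0 : p != 0.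
Let hO : bigO_pow 1 (fun h : R => h).
Proof. exact: bigO_powX 1. Qed.

(** Residual of the exact solution in the stage velocity, whose two weights both equal [p / 2] when
    [6 p^2 - 6 p + 1 = 0]. The real [k] locates the start of the step. *)
Definition velocity_defect k h :=
  du 1 (t + (k + p) * h) - du 1 (t + k * h)
  - h * (p / 2 * (du 2 (t + k * h) + du 2 (t + (k + p) * h))).

Definition displacement_defect k h :=
  du 0 (t + (k + p) * h) - du 0 (t + k * h) - h * (p * du 1 (t + k * h))
  - h ^+ 2 * (p ^+ 2 / 2 * du 2 (t + k * h)).

(** This is the trapezoidal rule for [du 2] over length [p h], with its classical error
    [- (p h)^3 / 12] times the second derivative of the integrand. *)
Lemma velocity_defect_bigO k :
  bigO_pow 4 (fun h => velocity_defect k h - - (p ^+ 3 / 12 * du 4 t) * h ^+ 3).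
Proof.
have T1 := taylor4 (k + p) 1; have T2 := taylor4 k 1.
have T3 := taylor3 k 2; have T4 := taylor3 (k + p) 2.
apply: bigO_pow_eq (bigO_powB _ _ _ (bigO_powB _ _ _ T1 T2)
  (bigO_powM _ _ _ _ hO (bigO_powZ _ (p / 2) _ (bigO_powD _ _ _ T3 T4)))).
by move=> h; rewrite /velocity_defect; field.
Qed.

Lemma displacement_defect_bigO k :
  bigO_pow 4 (fun h => displacement_defect k h - p ^+ 3 / 6 * du 3 t * h ^+ 3).
Proof.
have T1 := taylor4 (k + p) 0; have T2 := taylor4 k 0.
have T3 := taylor3 k 1.
(* [du 2] carries a factor [h ^+ 2], so its expansion stops at order 2; the quadratic term moves
   into the remainder. *)
have T4 : bigO_pow 2 (fun h => du 2 (t + k * h) - (du 2 t + du 3 t * (k * h))).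
  apply: bigO_pow_eq (bigO_powD _ _ _
    (bigO_pow_le 2 3 _ isT (taylor3 k 2)) (bigO_pow_cX 2 (du 4 t / 2 * k ^+ 2))).
  by move=> h; field.
apply: bigO_pow_eq (bigO_powB _ _ _ (bigO_powB _ _ _ (bigO_powB _ _ _ T1 T2)
  (bigO_powM _ _ _ _ hO (bigO_powZ _ p _ T3)))
  (bigO_powM _ _ _ _ (bigO_powX 2) (bigO_powZ _ (p ^+ 2 / 2) _ T4))).
by move=> h; rewrite /displacement_defect; field.
Qed.

(* In the next three lemmas, [d] is the error of the intermediate
   acceleration computed by the step. *)
Lemma displacement_error_bigO k (d : R -> R) : bigO_pow 3 d ->
  bigO_pow 5 (fun h => du 0 (t + (k + 1) * h) - du 0 (t + k * h)
    - h * du 1 (t + k * h)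
    - h ^+ 2 * ((3 * p - 1) / (6 * p) * du 2 (t + k * h)
                + 1 / (6 * p) * (du 2 (t + (k + p) * h) + d h))
    - du 4 t * (1 / 24 - p / 12) * h ^+ 4).
Proof.
move=> Od; have T1 := taylor5 (k + 1) 0; have T2 := taylor5 k 0.
have T3 := taylor4 k 1; have T4 := taylor3 k 2; have T5 := taylor3 (k + p) 2.
(* The weights of [du 2] sum to 1/2 with first moment 1/6, which matches Taylor through [h^3]; the
   [h^4] coefficient is free of [k], and [h^2 d] has order 5. *)
apply: bigO_pow_eq (bigO_powB _ _ _ (bigO_powB _ _ _ (bigO_powB _ _ _ T1 T2)
  (bigO_powM _ _ _ _ hO T3))
  (bigO_powM _ _ _ _ (bigO_powX 2)
    (bigO_powD _ _ _ (bigO_powZ _ ((3 * p - 1) / (6 * p)) _ T4)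
      (bigO_powZ _ (1 / (6 * p)) _ (bigO_powD _ _ _ T5 Od))))).
by move=> h; field.
Qed.

Lemma velocity_error_bigO k (d : R -> R) (d3 : R) :
  bigO_pow 4 (fun h => d h - d3 * h ^+ 3) ->
  bigO_pow 5 (fun h => du 1 (t + (k + 1) * h) - du 1 (t + k * h)
    - h * ((2 * p - 1) / (2 * p) * du 2 (t + k * h)
           + 1 / (2 * p) * (du 2 (t + (k + p) * h) + d h))
    - (du 4 t * (1 / 6 - p / 4) * h ^+ 3
       + (du 5 t * (1 / 24 - p ^+ 2 / 12) - d3 / (2 * p)
          + k * (du 5 t * (1 / 6 - p / 4))) * h ^+ 4)).
Proof.
move=> Od; have T1 := taylor5 (k + 1) 1; have T2 := taylor5 k 1.
have T4 := taylor4 k 2; have T5 := taylor4 (k + p) 2.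
(* The weights have sum 1 and first moment 1/2; the second moment is [p/2] in place of 1/3, whence
   [1/6 - p/4] at [h^3]. Moving the base point from [t] to [t + k h] produces the term in [k]. *)
apply: bigO_pow_eq (bigO_powB _ _ _ (bigO_powB _ _ _ T1 T2)
  (bigO_powM _ _ _ _ hO
    (bigO_powD _ _ _ (bigO_powZ _ ((2 * p - 1) / (2 * p)) _ T4)
      (bigO_powZ _ (1 / (2 * p)) _ (bigO_powD _ _ _ T5 Od))))).
by move=> h; field.
Qed.

Lemma acceleration_error_bigO k (d : R -> R) (d3 : R) :
  bigO_pow 4 (fun h => d h - d3 * h ^+ 3) ->
  bigO_pow 4 (fun h => du 2 (t + (k + 1) * h)
    - ((p - 1) / p * du 2 (t + k * h) + 1 / p * (du 2 (t + (k + p) * h) + d h))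
    - (du 4 t * ((1 - p) / 2) * h ^+ 2
       + (du 5 t * ((1 - p ^+ 2) / 6) - d3 / p
          + k * (du 5 t * ((1 - p) / 2))) * h ^+ 3)).
Proof.
move=> Od; have T1 := taylor4 (k + 1) 2.
have T4 := taylor4 k 2; have T5 := taylor4 (k + p) 2.
(* The weights have sum and first moment 1, but second moment [p] in place of 1, whence [(1 - p)/2]
   at [h^2]. *)
apply: bigO_pow_eq (bigO_powB _ _ _ T1
    (bigO_powD _ _ _ (bigO_powZ _ ((p - 1) / p) _ T4)
      (bigO_powZ _ (1 / p) _ (bigO_powD _ _ _ T5 Od)))).
by move=> h; field.
Qed.

End TaylorExpansions.

(** * One-step form of the algorithm *)

Section SingleSolve.
Context {R : realType}.
Local Open Scope classical_set_scope.
Local Open Scope ring_scope.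
Variables (p xi omega : R).
Hypothesis p_root : 6 * p ^+ 2 - 6 * p + 1 = 0.
Hypothesis p_gt0 : 0 < p.
Hypothesis xi_ge0 : 0 <= xi.
Hypothesis omega_gt0 : 0 < omega.
Local Notation c := (2 * xi * omega).
Local Notation i1 := (@displacement).
Local Notation i2 := (@velocity).
Local Notation i3 := (@acceleration).

(** Inverse of the coefficient of the stage acceleration once the stage velocity is eliminated from
    the implicit equation. *)
Definition stage_scale (dt : R) : R := (1 + c * (p / 2) * dt)^-1.

(** Minus the linear dependence of the stage acceleration on the state; transposed, it enters
    [num_matrix] as a rank-one correction. *)
Definition stage_row (dt : R) : 'cV[R]_3 := stage_scale dt *:
  state (omega ^+ 2) (c + omega ^+ 2 * p * dt)
    ((c * (p / 2) + omega ^+ 2 * (p ^+ 2 / 2) * dt) * dt).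

Definition stage_weights (dt : R) : 'cV[R]_3 :=
  state (dt ^+ 2 * (1 / (6 * p))) (dt * (1 / (2 * p))) (1 / p).

(** The update with the stage acceleration set to zero; the list holds the columns. *)
Definition predictor (dt : R) : 'M[R]_3 := \matrix_(i, j)
  [:: state 1 0 0; state dt 1 0;
      state (dt ^+ 2 * ((3 * p - 1) / (6 * p))) (dt * ((2 * p - 1) / (2 * p)))
        ((p - 1) / p)]`_j i 0.

Definition num_matrix (dt : R) : 'M[R]_3 :=
  predictor dt - stage_weights dt *m (stage_row dt)^T.

Definition num_load (f : R -> R) (dt t : R) : 'cV[R]_3 :=
  (stage_scale dt * f (t + p * dt)) *: stage_weights dt.

Definition stage_acceleration (f : R -> R) (dt t u v a : R) : R :=
  stage_scale dt * (f (t + p * dt)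
    - (omega ^+ 2 * u + (c + omega ^+ 2 * p * dt) * v
       + (c * (p / 2) + omega ^+ 2 * (p ^+ 2 / 2) * dt) * dt * a)).

Lemma num_stepE f dt t u v a (ap := stage_acceleration f dt t u v a) :
  num_matrix dt *m state u v a + num_load f dt t =
  state (u + dt * v + dt ^+ 2 * ((3 * p - 1) / (6 * p) * a + 1 / (6 * p) * ap))
    (v + dt * ((2 * p - 1) / (2 * p) * a + 1 / (2 * p) * ap))
    ((p - 1) / p * a + 1 / p * ap).
Proof.
apply/matrixP => i j; rewrite (ord1 j) !mxE big_ord3 !mxE !big_ord1 !mxE /=.
rewrite {}/ap /stage_acceleration.
move: (1 / (6 * p)) (1 / (2 * p)) (1 / p) ((3 * p - 1) / (6 * p))
  ((2 * p - 1) / (2 * p)) ((p - 1) / p) (stage_scale dt) => *.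
by case: i => [[|[|[|//]]] Hi] /=; ring.
Qed.

Lemma stateP (u v a u' v' a' : R) :
  state u v a = state u' v' a' <-> [/\ u = u', v = v' & a = a'].
Proof.
split=> [/matrixP E|[-> -> ->]//].
by split; [have := E i1 0|have := E i2 0|have := E i3 0]; rewrite !mxE.
Qed.

Lemma stage_scale_den_gt0 dt : 0 < dt -> 0 < 1 + c * (p / 2) * dt.
Proof.
move=> dt0; apply: ltr_wpDr => //.
have := (ltW p_gt0, ltW omega_gt0, ltW dt0); move=> [[? ?] ?].
by rewrite !mulr_ge0 ?invr_ge0 //.
Qed.

(** The relation [p_root] brings the weights of the algorithm to the forms used in [predictor] and
    [stage_weights]; the implicit equation is linear with positive leading coefficient, and its
    unique solution is [stage_acceleration]. *)
Lemma single_solve_one_step : one_step_form (single_solve p) xi omega num_matrix num_load.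
Proof.
move=> f dt _ dt0 t u v a u1 v1 a1; rewrite num_stepE stateP.
have den0 := lt0r_neq0 (stage_scale_den_gt0 dt dt0).
have pn0 := lt0r_neq0 p_gt0.
have sq : 6 * p ^+ 2 = 6 * p - 1.
  by apply/eqP; rewrite -subr_eq0; apply/eqP; rewrite -p_root; ring.
have w1 : (12 * p ^+ 2 - 6 * p + 1) / (12 * p) = p / 2.
  by rewrite (_ : 12 * p ^+ 2 - 6 * p + 1 = 6 * p ^+ 2); [field|lra].
have w2 : (6 * p - 1) / (12 * p) = p / 2 by rewrite -sq; field.
have w3 : (6 * p ^+ 2 - 1) / (12 * p) = (3 * p - 1) / (6 * p) by rewrite sq; field.
have w4 : (- 6 * p ^+ 2 + 6 * p + 1) / (12 * p) = 1 / (6 * p).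
  by rewrite (_ : - 6 * p ^+ 2 + 6 * p + 1 = 2); [field|lra].
rewrite /single_solve w1 w2 w3 w4 /test_force.
have scaleE x y : x = stage_scale dt * y <-> x * (1 + c * (p / 2) * dt) = y.
  rewrite /stage_scale; split=> [->|<-]; first by rewrite mulrAC mulVf ?mul1r.
  by rewrite mulrCA mulVf ?mulr1.
split=> [[ap [vp [up [[E1 E2 E3] [-> -> ->]]]]]|[-> -> ->]].
  suff -> : ap = stage_acceleration f dt t u v a by [].
  apply/scaleE; move: E1; rewrite mul1r E2 E3 => E1.
  rewrite mulrDr mulr1 {1}E1; ring.
set ap := stage_acceleration f dt t u v a.
exists ap, (v + dt * (p / 2 * a + p / 2 * ap)),
  (u + p * dt * v + p ^+ 2 / 2 * dt ^+ 2 * a).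
split=> //; split=> //.
have /scaleE E : ap = stage_acceleration f dt t u v a by [].
(* Adding the implicit damping term collects the factor [1 + c * (p / 2) * dt] on the left, where
   [E] applies. *)
rewrite mul1r; apply: (addIr (ap * (c * (p / 2) * dt))).
by rewrite -[X in X + _ = _]mulr1 -mulrDr E; ring.
Qed.

Lemma stage_scale_bigO : bigO_pow 0 stage_scale.
Proof.
exists 1 => //; near=> h; have h0 : 0 < h by near: h; exact: nbhs_right_gt.
have d0 := stage_scale_den_gt0 h h0.
rewrite mulr1 /stage_scale normfV (gtr0_norm d0) invf_le1// lerDl.
have := (ltW p_gt0, ltW omega_gt0, ltW h0); move=> [[? ?] ?].
by rewrite !mulr_ge0 ?invr_ge0.
Unshelve. all: by end_near. Qed.

(** The test equation at [s + p * h] replaces [f]; what remains are the residuals of the stage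
    velocity and displacement, weighted by the damping and stiffness coefficients. *)
Lemma stage_accelerationE f u h s : test_solution xi omega f u -> 0 < h ->
  stage_acceleration f h s (u s) (u^`()%classic s) (u^`(2)%classic s) =
  u^`(2)%classic (s + p * h) + stage_scale h *
    (c * (u^`()%classic (s + p * h) - u^`()%classic s
          - h * (p / 2 * (u^`(2)%classic s + u^`(2)%classic (s + p * h))))
     + omega ^+ 2 * (u (s + p * h) - u s - h * (p * u^`()%classic s)
          - h ^+ 2 * (p ^+ 2 / 2 * u^`(2)%classic s))).
Proof.
move=> su h0; rewrite /stage_acceleration; have [_ _ <-] := su (s + p * h).
have scaleK : stage_scale h * (1 + c * (p / 2) * h) = 1.
  by rewrite mulVf// lt0r_neq0// stage_scale_den_gt0.
move: (u^`(2)%classic (s + p * h)) (u^`()%classic (s + p * h)) (u (s + p * h)).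
move: (u^`(2)%classic s) (u^`()%classic s) (u s) => a v x a' v' x'.
apply/eqP; rewrite -subr_eq0; apply/eqP.
transitivity ((stage_scale h * (1 + c * (p / 2) * h) - 1) * a').
  by move: (stage_scale h) => ?; field.
by rewrite scaleK subrr mul0r.
Qed.

(** * One-step errors along an exact solution *)

Section LocalError.
Variables (f u : R -> R) (t : R).
Hypothesis sf : smooth f.
Hypothesis su : test_solution xi omega f u.
Let du (i : nat) : R -> R := u^`(i)%classic.
Let e k h i := local_error (num_matrix h) (num_load f h) u h (t + k%:R * h) i 0.

Let smooth_u : smooth u.
Proof. exact: test_solution_smooth sf su. Qed.

Let du_taylor th i n : bigO_pow n (fun h => du i (t + th * h) -
  \sum_(j < n) du (i + j)%N t / j`!%:R * (th * h) ^+ j).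
Proof. exact: taylor_deriven_bigO. Qed.

Definition stage_defect k h := stage_scale h *
  (c * velocity_defect du t p k h + omega ^+ 2 * displacement_defect du t p k h).

Let d3 := c * - (p ^+ 3 / 12 * du 4 t) + omega ^+ 2 * (p ^+ 3 / 6 * du 3 t).

(** Since [stage_scale h = 1 + O(h)], the leading coefficient [d3] just combines those of the two
    defects. *)
Lemma stage_defect_bigO k : bigO_pow 4 (fun h => stage_defect k h - d3 * h ^+ 3).
Proof.
have Ov := velocity_defect_bigO du t du_taylor p k.
have Od := displacement_defect_bigO du t du_taylor p k.
have Os := stage_scale_bigO; have hO : bigO_pow 1 (fun h : R => h) := bigO_powX 1.
(* The last summand, of order 4, pays for replacing [stage_scale h] by 1 in front of
   [d3 * h ^+ 3]. *)
apply: bigO_pow_near (_ : bigO_pow 4 (fun h => stage_scale h *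
  (c * (velocity_defect du t p k h - - (p ^+ 3 / 12 * du 4 t) * h ^+ 3)
   + omega ^+ 2 * (displacement_defect du t p k h - p ^+ 3 / 6 * du 3 t * h ^+ 3))
  - c * (p / 2) * (stage_scale h * h * (d3 * h ^+ 3)))); last by bigO_auto.
near=> h; have h0 : 0 < h by near: h; exact: nbhs_right_gt.
have scaleK : stage_scale h * (1 + c * (p / 2) * h) = 1.
  by rewrite mulVf// lt0r_neq0// stage_scale_den_gt0.
have -> : stage_defect k h - d3 * h ^+ 3 =
    stage_defect k h - stage_scale h * (1 + c * (p / 2) * h) * d3 * h ^+ 3.
  by rewrite scaleK mul1r.
rewrite /stage_defect /d3.
move: (velocity_defect _ _ _ _ _) (displacement_defect _ _ _ _ _).
by move: (du 4 t) (du 3 t) (stage_scale h) => *; field.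
Unshelve. all: by end_near. Qed.

Lemma local_errorE k h : 0 < h ->
  [/\ e k h i1 = du 0 (t + (k%:R + 1) * h) - du 0 (t + k%:R * h)
        - h * du 1 (t + k%:R * h)
        - h ^+ 2 * ((3 * p - 1) / (6 * p) * du 2 (t + k%:R * h)
                + 1 / (6 * p) * (du 2 (t + (k%:R + p) * h) + stage_defect k%:R h)),
      e k h i2 = du 1 (t + (k%:R + 1) * h) - du 1 (t + k%:R * h)
        - h * ((2 * p - 1) / (2 * p) * du 2 (t + k%:R * h)
           + 1 / (2 * p) * (du 2 (t + (k%:R + p) * h) + stage_defect k%:R h))
    & e k h i3 = du 2 (t + (k%:R + 1) * h)
        - ((p - 1) / p * du 2 (t + k%:R * h)
           + 1 / p * (du 2 (t + (k%:R + p) * h) + stage_defect k%:R h))].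
Proof.
move=> h0; rewrite /stage_defect /velocity_defect /displacement_defect.
rewrite /e /local_error -addrA -opprD /exact_state num_stepE stage_accelerationE//.
have -> : t + (k%:R + 1) * h = t + k%:R * h + h by ring.
have -> : t + (k%:R + p) * h = t + k%:R * h + p * h by ring.
by rewrite !mxE; split; rewrite // opprD addrA // opprD addrA.
Qed.

Let pn0 : p != 0. Proof. exact: lt0r_neq0. Qed.

Lemma local_error_displacement k :
  bigO_pow 5 (fun h => e k h i1 - du 4 t * (1 / 24 - p / 12) * h ^+ 4).
Proof.
have Od : bigO_pow 3 (stage_defect k%:R).
  have Od := stage_defect_bigO k%:R.
  apply: bigO_pow_eq (_ : bigO_pow 3 (fun h =>
    (stage_defect k%:R h - d3 * h ^+ 3) + d3 * h ^+ 3)); last by bigO_auto.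
  by move=> h; rewrite subrK.
apply: bigO_pow_near (displacement_error_bigO du t du_taylor p pn0 k%:R _ Od).
near=> h; have h0 : 0 < h by near: h; exact: nbhs_right_gt.
by have [-> _ _] := local_errorE k h h0.
Unshelve. all: by end_near. Qed.

(** The constant [g] is the same for all steps, so it drops out of differences between steps; only
    the drift term survives. *)
Lemma local_error_velocity : exists g : R, forall k,
  bigO_pow 5 (fun h => e k h i2 - (du 4 t * (1 / 6 - p / 4) * h ^+ 3
       + (g + k%:R * (du 5 t * (1 / 6 - p / 4))) * h ^+ 4)).
Proof.
eexists => k; apply: bigO_pow_near (velocity_error_bigO du t du_taylor p pn0
  k%:R _ d3 (stage_defect_bigO k%:R)).
near=> h; have h0 : 0 < h by near: h; exact: nbhs_right_gt.
by have [_ -> _] := local_errorE k h h0.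
Unshelve. all: by end_near. Qed.

Lemma local_error_acceleration : exists g : R, forall k,
  bigO_pow 4 (fun h => e k h i3 - (du 4 t * ((1 - p) / 2) * h ^+ 2
       + (g + k%:R * (du 5 t * ((1 - p) / 2))) * h ^+ 3)).
Proof.
eexists => k; apply: bigO_pow_near (acceleration_error_bigO du t du_taylor p pn0
  k%:R _ d3 (stage_defect_bigO k%:R)).
near=> h; have h0 : 0 < h by near: h; exact: nbhs_right_gt.
by have [_ _ ->] := local_errorE k h h0.
Unshelve. all: by end_near. Qed.

(** * Entries of [I - D] and the cancellation at the chosen [p] *)

Let n i j h := (1%:M - num_matrix h) i j.

Let nE i j h : n i j h = (i == j)%:R
  - (predictor h i j - stage_weights h i 0 * stage_row h j 0).
Proof.
rewrite /n mxE [1%:M _ _]mxE [(- num_matrix h) _ _]mxE [num_matrix h _ _]mxE.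
by rewrite [(- (_ *m _)) _ _]mxE [(_ *m _) _ _]mxE big_ord1 [_^T _ _]mxE.
Qed.

Let stage_row_bigO : [/\ bigO_pow 0 (fun h => stage_row h i1 0),
  bigO_pow 0 (fun h => stage_row h i2 0) & bigO_pow 1 (fun h => stage_row h i3 0)].
Proof.
have Os := stage_scale_bigO; have hO : bigO_pow 1 (fun h : R => h) := bigO_powX 1.
split.
- apply: bigO_pow_eq (_ : bigO_pow 0 (fun h => stage_scale h * omega ^+ 2)).
    by move=> h; rewrite !mxE.
  by bigO_auto.
- apply: bigO_pow_eq (_ : bigO_pow 0 (fun h =>
    stage_scale h * (c + omega ^+ 2 * p * h))).
    by move=> h; rewrite !mxE.
  by bigO_auto.
- apply: bigO_pow_eq (_ : bigO_pow 1 (fun h =>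
    stage_scale h * ((c * (p / 2) + omega ^+ 2 * (p ^+ 2 / 2) * h) * h))).
    by move=> h; rewrite !mxE.
  by bigO_auto.
Qed.

(** The powers of [h] come from [predictor] and [stage_weights]. The third entry of [stage_row] has
    order 1, so the leading terms of column 3 come from the identity and [predictor]. *)
Let n_bigO : [/\
  [/\ bigO_pow 2 (n i1 i1), bigO_pow 2 (fun h => n i1 i2 h + h) & bigO_pow 2 (n i1 i3)],
  [/\ bigO_pow 1 (n i2 i1), bigO_pow 1 (n i2 i2) &
      bigO_pow 2 (fun h => n i2 i3 h + (2 * p - 1) / (2 * p) * h)] &
  [/\ bigO_pow 0 (n i3 i1), bigO_pow 0 (n i3 i2) &
      bigO_pow 1 (fun h => n i3 i3 h - 1 / p)]].
Proof.
have hO : bigO_pow 1 (fun h : R => h) := bigO_powX 1.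
have hhO : bigO_pow 2 (fun h : R => h ^+ 2) := bigO_powX 2.
have [R1 R2 R3] := stage_row_bigO.
split; split.
- apply: bigO_pow_eq (_ : bigO_pow 2 (fun h =>
    h * (h * (1 / (6 * p) * stage_row h i1 0)))); last by bigO_auto.
  by move=> h; rewrite nE; move: (stage_row h) => r; rewrite !mxE /=; field.
- apply: bigO_pow_eq (_ : bigO_pow 2 (fun h =>
    h ^+ 2 * (1 / (6 * p) * stage_row h i2 0))); last by bigO_auto.
  by move=> h; rewrite nE; move: (stage_row h) => r; rewrite !mxE /=; field.
- apply: bigO_pow_eq (_ : bigO_pow 2 (fun h =>
    h ^+ 2 * (1 / (6 * p) * stage_row h i3 0 - (3 * p - 1) / (6 * p)))); last by bigO_auto.
  by move=> h; rewrite nE; move: (stage_row h) => r; rewrite !mxE /=; field.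
- apply: bigO_pow_eq (_ : bigO_pow 1 (fun h =>
    h * (1 / (2 * p) * stage_row h i1 0))); last by bigO_auto.
  by move=> h; rewrite nE; move: (stage_row h) => r; rewrite !mxE /=; field.
- apply: bigO_pow_eq (_ : bigO_pow 1 (fun h =>
    h * (1 / (2 * p) * stage_row h i2 0))); last by bigO_auto.
  by move=> h; rewrite nE; move: (stage_row h) => r; rewrite !mxE /=; field.
- apply: bigO_pow_eq (_ : bigO_pow 2 (fun h =>
    h * (1 / (2 * p) * stage_row h i3 0))); last by bigO_auto.
  by move=> h; rewrite nE; move: (stage_row h) => r; rewrite !mxE /=; field.
- apply: bigO_pow_eq (_ : bigO_pow 0 (fun h =>
    1 / p * stage_row h i1 0)); last by bigO_auto.
  by move=> h; rewrite nE; move: (stage_row h) => r; rewrite !mxE /=; field.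
- apply: bigO_pow_eq (_ : bigO_pow 0 (fun h =>
    1 / p * stage_row h i2 0)); last by bigO_auto.
  by move=> h; rewrite nE; move: (stage_row h) => r; rewrite !mxE /=; field.
- apply: bigO_pow_eq (_ : bigO_pow 1 (fun h =>
    1 / p * stage_row h i3 0)); last by bigO_auto.
  by move=> h; rewrite nE; move: (stage_row h) => r; rewrite !mxE /=; field.
Qed.

Let a_ := du 4 t * ((1 - p) / 2).
Let a'_ := du 5 t * ((1 - p) / 2).
Let b_ := du 4 t * (1 / 6 - p / 4).
Let b'_ := du 5 t * (1 / 6 - p / 4).

(** With [x] the fourth or fifth derivative of [u] at [t] this is [ab] or [ab']; it ties the
    cancellation of leading errors to the quadratic equation for [p]. *)
Let cancel x : 1 / p * (x * (1 / 6 - p / 4))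
  + (2 * p - 1) / (2 * p) * (x * ((1 - p) / 2)) = 0.
Proof.
transitivity (- (6 * p ^+ 2 - 6 * p + 1) * x / (12 * p)); first by field.
by rewrite p_root oppr0 !mul0r.
Qed.

Let Eu0 : bigO_pow 4 (fun h => e 0 h i1).
Proof.
have E0 := local_error_displacement 0.
apply: bigO_pow_eq (_ : bigO_pow 4 (fun h =>
  (e 0 h i1 - du 4 t * (1 / 24 - p / 12) * h ^+ 4)
  + du 4 t * (1 / 24 - p / 12) * h ^+ 4)); last by bigO_auto.
by move=> h; rewrite subrK.
Qed.

Let Eu k : bigO_pow 5 (fun h => e k h i1 - e 0 h i1).
Proof.
apply: bigO_pow_eq (bigO_powB _ _ _ (local_error_displacement k)
  (local_error_displacement 0)).
by move=> h; move: (e k h i1) (e 0 h i1) (du 4 t) => *; ring.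
Qed.

Let Ev0 : bigO_pow 4 (fun h => e 0 h i2 - b_ * h ^+ 3).
Proof.
have [g /(_ 0) E0] := local_error_velocity.
apply: bigO_pow_eq (bigO_powD _ _ _ (bigO_pow_le 4 5 _ isT E0) (bigO_pow_cX 4 g)).
by move=> h; rewrite /b_; move: (e 0 h i2) (du 4 t) (du 5 t) => *; ring.
Qed.

Let Ev k : bigO_pow 5 (fun h => e k h i2 - e 0 h i2 - k%:R * b'_ * h ^+ 4).
Proof.
have [g Eg] := local_error_velocity.
apply: bigO_pow_eq (bigO_powB _ _ _ (Eg k) (Eg 0)).
move=> h; rewrite /b'_; move: (e k h i2) (e 0 h i2).
by move: (du 4 t) (du 5 t) => *; ring.
Qed.

Let Ea0 : bigO_pow 3 (fun h => e 0 h i3 - a_ * h ^+ 2).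
Proof.
have [g /(_ 0) E0] := local_error_acceleration.
apply: bigO_pow_eq (bigO_powD _ _ _ (bigO_pow_le 3 4 _ isT E0) (bigO_pow_cX 3 g)).
by move=> h; rewrite /a_; move: (e 0 h i3) (du 4 t) (du 5 t) => *; ring.
Qed.

Let Ea k : bigO_pow 4 (fun h => e k h i3 - e 0 h i3 - k%:R * a'_ * h ^+ 3).
Proof.
have [g Eg] := local_error_acceleration.
apply: bigO_pow_eq (bigO_powB _ _ _ (Eg k) (Eg 0)).
move=> h; rewrite /a'_; move: (e k h i3) (e 0 h i3).
by move: (du 4 t) (du 5 t) => *; ring.
Qed.

Lemma single_solve_truncation :
  [/\ bigO_pow 3 (fun h =>
        truncation_error (num_matrix h) (num_load f h) u t h displacement 0),
      bigO_pow 3 (fun h =>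
        truncation_error (num_matrix h) (num_load f h) u t h velocity 0)
    & bigO_pow 2 (fun h =>
        truncation_error (num_matrix h) (num_load f h) u t h acceleration 0)].
Proof.
have [[N11 N12 N13] [N21 N22 N23] [N31 N32 N33]] := n_bigO.
split.
- have := order_displacement _ _ _ _ _ _ _ _ _ _ _ _
    (fun k h => e k h i1) (fun k h => e k h i2) (fun k h => e k h i3)
    (cancel _) N12 N13 N22 N23 N32 N33 Eu0 Eu Ev0 Ev Ea0 Ea.
  move/(bigO_pow_divX 2 3); apply: bigO_pow_eq => h.
  by have [-> _ _] := truncation_error_components (num_matrix h) (num_load f h) u t h.
- have := order_velocity _ _ _ _ _ _ _ _ _ _ _ _
    (fun k h => e k h i1) (fun k h => e k h i2) (fun k h => e k h i3)
    (cancel _) N11 N13 N21 N23 N31 N33 Eu0 Eu Ev0 Ev Ea0 Ea.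
  move/(bigO_pow_divX 2 3); apply: bigO_pow_eq => h.
  by have [_ -> _] := truncation_error_components (num_matrix h) (num_load f h) u t h.
- have := order_acceleration _ _ _ _ _ _ _ _ _ _
    (fun k h => e k h i1) (fun k h => e k h i2) (fun k h => e k h i3)
    N11 N12 N21 N22 N31 N32 Eu0 Eu Ev0 Ev Ea0 Ea.
  move/(bigO_pow_divX 2 2); apply: bigO_pow_eq => h.
  by have [_ _ ->] := truncation_error_components (num_matrix h) (num_load f h) u t h.
Qed.

End LocalError.
End SingleSolve.

Theorem mainTheorem3 (R : realType) (p xi omega : R) :
  p = (3 + Num.sqrt 3) / 6 ->
  0 <= xi -> xi < 1 -> 0 < omega ->
  [/\ order_accurate (single_solve p) xi omega displacement 3,
      order_accurate (single_solve p) xi omega velocity 3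
    & order_accurate (single_solve p) xi omega acceleration 2].
Proof.
move=> pE xi0 _ omega0.
have p0 : 0 < p by rewrite pE divr_gt0 // ltr_wpDr // sqrtr_ge0.
have p_root : 6 * p ^+ 2 - 6 * p + 1 = 0.
  have : Num.sqrt 3 ^+ 2 = 3 :> R by rewrite sqr_sqrtr.
  (* Squaring [6 p - 3] then gives [36 p^2 - 36 p + 6 = 0]. *)
  have -> : Num.sqrt 3 = 6 * p - 3 by rewrite pE; field.
  by move=> sq; nra.
have step := single_solve_one_step p xi omega p_root p0 xi0 omega0.
have trunc f u sf su t :=
  single_solve_truncation p xi omega p_root p0 xi0 omega0 f u t sf su.
split; exists (num_matrix p xi omega), (num_load p xi omega); split=> // f u sf su t.
- by have [/bigO_powP ? _ _] := trunc f u sf su t.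
- by have [_ /bigO_powP ? _] := trunc f u sf su t.
- by have [_ _ /bigO_powP ?] := trunc f u sf su t.
Qed.
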